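(* Let $n\ge 2$. There exists a compact set $E\subset\mathbb{R}^n$ of Hausdorff dimension $n/2$ such that the distance set $D(E)$ has Lebesgue measure zero, $E$ does not contain two distinct points at rational distance, $E$ does not contain three distinct collinear points, and moreover every (nonzero) distance and every direction is realised at most once by $E$.
   Context: The distance set of $E\subset\mathbb{R}^n$ is $D(E)=\{|x-y| : x,y\in E\}\subset\mathbb{R}$. ''Every distance is realised at most once by $E$'' means: if $x,y,z,v\in E$ with $|x-y|=|z-v|>0$, then $\{x,y\}=\{z,v\}$. ''Every direction is realised at most once by $E$'' means: if $x,y,z,v\in E$, $x\ne y$, $z\neq v$, and $x-y$ is parallel to $z-v$ (i.e. a real scalar multiple of it), then $\{x,y\}=\{z,v\}$. *)

(* Defs.v *)
From HB Require Import structures.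
From mathcomp Require Import all_boot all_order all_algebra.
From mathcomp Require Import all_classical all_reals all_analysis.
Set Implicit Arguments.
Unset Strict Implicit.
Unset Printing Implicit Defensive.
Import Order.TTheory GRing.Theory Num.Theory.
Import numFieldNormedType.Exports.
Local Open Scope classical_set_scope.
Local Open Scope ring_scope.

(* The library norm on row vectors is the sup norm; the Euclidean norm has to
   be defined separately. Both induce the same topology, so that the library's
   [compact] is the usual compactness. *)
Definition eucl_norm (R : realType) (n : nat) (x : 'rV[R]_n) : R :=
  Num.sqrt (\sum_(i < n) x ord0 i ^+ 2).

Definition eucl_dist (R : realType) (n : nat) (x y : 'rV[R]_n) : R :=
  eucl_norm (x - y).

Definition distance_set (R : realType) (n : nat) (E : set 'rV[R]_n) : set R :=
  [set d | exists x y, [/\ E x, E y & d = eucl_dist x y]].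

(* Equal to -oo on the empty set; [diam_pow] treats that case apart. *)
Definition ediam (R : realType) (n : nat) (U : set 'rV[R]_n) : \bar R :=
  ereal_sup [set d%:E | d in distance_set U].

(* diam(U)^s, with the conventions diam(set0)^s = 0 for all s, and 0^0 = 1 on
   nonempty sets. *)
Definition diam_pow (R : realType) (n : nat) (s : R) (U : set 'rV[R]_n) :
  \bar R := if U == set0 then 0%E else poweR (ediam U) s.

(* Finite covers are included, since the sets may be empty. *)
Definition delta_cover (R : realType) (n : nat) (delta : R)
    (E : set 'rV[R]_n) (U : nat -> set 'rV[R]_n) : Prop :=
  E `<=` \bigcup_i U i /\ forall i, (ediam (U i) <= delta%:E)%E.

Definition hausdorff_content (R : realType) (n : nat) (s delta : R)
    (E : set 'rV[R]_n) : \bar R :=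
  ereal_inf [set (\sum_(0 <= i <oo) diam_pow s (U i))%E
            | U in delta_cover delta E].

(* The limit as delta tends to 0 is a supremum, by monotonicity in delta. *)
Definition hausdorff_measure (R : realType) (n : nat) (s : R)
    (E : set 'rV[R]_n) : \bar R :=
  ereal_sup [set hausdorff_content s delta E
            | delta in [set delta : R | 0 < delta]].

Definition hausdorff_dim (R : realType) (n : nat) (E : set 'rV[R]_n) : \bar R :=
  ereal_inf [set s%:E | s in [set s : R | 0 <= s /\
    hausdorff_measure s E = 0%E]].

Definition collinear (R : realType) (n : nat) (x y z : 'rV[R]_n) : Prop :=
  exists p d : 'rV[R]_n, d != 0 /\
    forall w, w \in [:: x; y; z] -> exists t : R, w = p + t *: d.

Definition distances_realised_once (R : realType) (n : nat)
    (E : set 'rV[R]_n) : Prop :=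
  forall x y z v, E x -> E y -> E z -> E v ->
    eucl_dist x y = eucl_dist z v -> 0 < eucl_dist z v -> [set x; y] = [set z; v].

Definition directions_realised_once (R : realType) (n : nat)
    (E : set 'rV[R]_n) : Prop :=
  forall x y z v, E x -> E y -> E z -> E v -> x != y -> z != v ->
    (exists t : R, x - y = t *: (z - v)) -> [set x; y] = [set z; v].

(* Main.v *)
(* Every coordinate of a point of [E] is written in binary. With [N = 2 ^ n_k]
   for a doubly exponential sequence [n_k], the digits in a zone slightly longer
   than [n_k, 2 n_k) are all zero, except for one digit near the end of the zone,
   worth [theta / N ^ 2], which records whether that coordinate is shifted at
   stage [k]; the other digits are free, apart from sparse zeros that prevent
   carries. So at stage [k] the point lies within [eta / N ^ 2] of the lattice
   [N^-1 Z^n], up to the shift, where [eta] is much smaller than [theta], which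
   tends to 0. Hence [N ^ 2 |x - y| ^ 2] is within [O(theta)] of an integer, and
   distances form a null set. If moreover only the [i]th coordinate of [x] is
   shifted, and nothing in [y], [z], [v], then [N ^ 2 (|x - y| ^ 2 - |z - v| ^ 2)]
   is an integer plus [2 theta (x_i - y_i) + O(eta)], and so, for large [k], it is
   not a fixed rational times [N ^ 2], because [x_i <> y_i] for some [i]. Likewise
   for the quadratic polynomials expressing that [x - y] and [z - v] are parallel.
   Every configuration is selected in this way at infinitely many stages. Finally
   [N ^ n] cells of diameter [O(N^-2)] cover [E], so the dimension is at most
   [n / 2], and reading off the free digits is a map from [E] whose image contains
   [0, 1) and which is Hoelder with every exponent below [n / 2]. *)

Require Import Defs.
From HB Require Import structures.
From mathcomp Require Import all_boot all_order all_algebra.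
From mathcomp Require Import all_classical all_reals all_analysis.
From mathcomp Require Import zify ring lra.
Import Order.TTheory GRing.Theory Num.Theory.
Import numFieldNormedType.Exports.
Local Open Scope classical_set_scope.
Local Open Scope ring_scope.
Set Implicit Arguments.
Unset Strict Implicit.
Unset Printing Implicit Defensive.

(** * Combinatorics of digit positions: zones, squares and free positions *)

Section Positions.
Local Open Scope nat_scope.

Definition tower k := 2 ^ (2 ^ k).
(** The factor 2 makes [2 * zone_start k] the square of [2 * tower k], so that the positions just
    after it, among them [shift_pos k] and [zone_end k], are not squares and can carry a nonzero
    digit. *)
Definition zone_start k := 2 * tower k ^ 2.
Definition shift_pos k := 2 * zone_start k + k.+1.
Definition zone_end k := 2 * zone_start k + k.+1.*2.

Definition in_zone k p := zone_start k <= p < zone_end k.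
Definition is_square p := [exists r : 'I_p.+1, r ^ 2 == p].
Definition is_free p := ~~ is_square p && ~~ [exists k : 'I_p.+1, in_zone k p].
Definition nfree p := \sum_(r < p) is_free r.

Lemma towerS k : tower k.+1 = tower k ^ 2.
Proof. by rewrite /tower expnS mulnC expnM. Qed.

Lemma tower_gt k : k.+1 < tower k.
Proof.
rewrite /tower; apply: leq_ltn_trans (ltn_expl (2 ^ k) (ltnSn 1)).
exact: ltn_expl.
Qed.

Lemma zone_start_gt k : k < zone_start k.
Proof. by rewrite /zone_start; have := tower_gt k; nia. Qed.

Lemma zone_end_lt k : zone_end k < zone_start k.+1.
Proof.
rewrite /zone_end /zone_start towerS; have := tower_gt k.
set a := tower k => ha; rewrite !expnS expn0 !muln1.
have : 2 * a <= a * a by nia.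
by move: (a * a) (ha) => b; nia.
Qed.

Lemma zone_start_homo : {homo zone_start : j k / j <= k}.
Proof.
apply: homo_leq => // [|k]; first exact: leq_trans.
by have := zone_end_lt k; rewrite /zone_end; lia.
Qed.

Lemma zone_end_lt_start j k : j < k -> zone_end j < zone_start k.
Proof.
by move=> jk; apply: leq_trans (zone_end_lt j) _; exact: zone_start_homo.
Qed.

Lemma in_zone_inj j k p : in_zone j p -> in_zone k p -> j = k.
Proof.
rewrite /in_zone => hj hk.
by case: (ltngtP j k) => // /zone_end_lt_start; lia.
Qed.

Lemma in_zone_shift k : in_zone k (shift_pos k).
Proof. by rewrite /in_zone /zone_end /shift_pos; lia. Qed.

Lemma is_squareP p : reflect (exists r, p = r ^ 2) (is_square p).
Proof.
apply: (iffP existsP) => [[r /eqP <-]|[r ->]]; first by exists r.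
have rp : r < (r ^ 2).+1 by rewrite ltnS; nia.
by exists (Ordinal rp) => /=.
Qed.

Lemma zoneP p : reflect (exists k, in_zone k p) [exists k : 'I_p.+1, in_zone k p].
Proof.
apply: (iffP existsP) => [[k hk]|[k hk]]; first by exists k.
have kp : k < p.+1 by move: hk; rewrite /in_zone; have := zone_start_gt k; lia.
by exists (Ordinal kp).
Qed.

Lemma free_notin_zone k p : is_free p -> ~~ in_zone k p.
Proof. by case/andP => _ h; apply: contra h => hk; apply/zoneP; exists k. Qed.

Lemma free_notsquare r : ~~ is_free (r ^ 2).
Proof. by rewrite negb_and negbK; apply/orP; left; apply/is_squareP; exists r. Qed.

(* The doubled start of a zone is the perfect square [(2 a)^2] with
   [a = tower k], and the next square is too far away. *)
Lemma zone_start2_nsquare k m : 0 < m <= k.+1.*2 ->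
  ~~ is_square (2 * zone_start k + m).
Proof.
move=> hm; apply/is_squareP => -[r]; rewrite /zone_start.
have := tower_gt k; set a := tower k => ha e.
have h1 : 2 * a < r by rewrite ltnNge; apply/negP => h; nia.
by nia.
Qed.

Lemma shift_pos_nsquare k : ~~ is_square (shift_pos k).
Proof. by apply: zone_start2_nsquare; lia. Qed.

Lemma shift_pos_inj : injective shift_pos.
Proof.
move=> j k e; apply: (@in_zone_inj j k (shift_pos j)).
  exact: in_zone_shift.
by rewrite e; exact: in_zone_shift.
Qed.

(** Provides a free position between any two consecutive zones, hence infinitely many free
    positions. *)
Lemma free_zone_end k : is_free (zone_end k).
Proof.
apply/andP; split; first by apply: zone_start2_nsquare; lia.
apply/zoneP => -[j]; rewrite /in_zone.
case: (ltngtP j k) => [jk|kj|->]; last by rewrite ltnn andbF.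
- have : zone_start k <= zone_end k by rewrite /zone_end; lia.
  by have := zone_end_lt_start jk; lia.
- by have := zone_end_lt_start kj; lia.
Qed.

Lemma nfreeS p : nfree p.+1 = nfree p + is_free p.
Proof. by rewrite /nfree big_ord_recr. Qed.

Lemma nfree_homo : {homo nfree : p q / p <= q}.
Proof.
apply: homo_leq => // [|p]; first exact: leq_trans.
by rewrite nfreeS leq_addr.
Qed.

Lemma nfree_le p : nfree p <= p.
Proof. by elim: p => [|p ih]; rewrite ?nfreeS /nfree ?big_ord0 //; case: is_free => /=; rewrite -/(nfree p); lia. Qed.

Lemma nfree_zone_start k : k <= nfree (zone_start k).
Proof.
elim: k => // k ih; have := nfreeS (zone_end k); rewrite free_zone_end.
have : nfree (zone_start k) <= nfree (zone_end k).
  by apply: nfree_homo; rewrite /zone_end; lia.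
by have := nfree_homo (zone_end_lt k); lia.
Qed.

Lemma nfree_zone_end k : nfree (zone_end k) = nfree (zone_start k).
Proof.
suff h m : zone_start k + m <= zone_end k ->
    nfree (zone_start k + m) = nfree (zone_start k).
  have e : zone_end k = zone_start k + (zone_end k - zone_start k).
    by rewrite /zone_end; lia.
  by rewrite {1}e h // -e.
elim: m => [|m ih]; rewrite ?addn0 // addnS => hm.
rewrite nfreeS ih; last lia.
case fr : is_free; rewrite ?addn0 //.
by have := free_notin_zone k fr; rewrite /in_zone; lia.
Qed.

Lemma free_pos_ex m : exists2 p, is_free p & nfree p = m.
Proof.
have ex : exists P, m < nfree P.
  by exists (zone_start m.+1); apply: nfree_zone_start.
case: (ex_minnP ex) => -[|p]; first by rewrite /nfree big_ord0.
rewrite nfreeS => hp /(_ p); rewrite ltnn => hm; exists p.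
  by move: hp hm; case: is_free => //=; rewrite addn0 => h /(_ h).
move: hp hm; case: is_free => /=; first by case: (ltngtP m (nfree p)) => //; lia.
by rewrite addn0 => h /(_ h).
Qed.

Lemma sum_itv_le a b p : \sum_(s < p) (a <= s < b) <= b - a.
Proof.
rewrite -(big_mkord xpredT (fun s => (a <= s < b) : nat)).
elim: p => [|p ih]; first by rewrite big_nil.
suff : \sum_(0 <= s < p) (a <= s < b) <= minn p b - a.
  by rewrite big_nat_recr //=; case: (a <= p < b) / idP; lia.
elim: p {ih} => [|p ih]; first by rewrite big_nil.
by rewrite big_nat_recr //=; case: (a <= p < b) / idP; lia.
Qed.

(** Zone [j] has length about [2 * tower j.+1], and the towers grow so fast that the last term
    dominates. *)
Lemma sum_zone_length k : \sum_(j < k) (zone_end j - zone_start j) <= 8 * tower k.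
Proof.
elim: k => [|k ih]; first by rewrite big_ord0.
rewrite big_ord_recr /= towerS; move: ih.
rewrite /zone_end /zone_start; have := tower_gt k; set a := tower k.
by set S := \sum_(_ < _) _; nia.
Qed.

(* The non-free positions below [p] are the squares, at most [r + 1] of them,
   the last zone, which occupies at most half of [0, p), and the earlier zones,
   of total length [O(r)]. *)
Lemma nfree_lower p r : is_free p -> r ^ 2 <= p < r.+1 ^ 2 ->
  p <= 2 * nfree p + 20 * r + 2.
Proof.
move=> fp hr.
have ex : exists k, p < zone_start k by exists p; exact: zone_start_gt.
have [K hK minK] := ex_minnP ex.
(* With [K] now the last zone starting at or before [p], twice the earlier zones is at most
   [16 * tower K <= 16 * r]. As [p] is free, it lies past zone [K], so twice that zone is at most
   [p + 2 * K.+1 <= p + 2 * r]. *)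
have hZ : 2 * \sum_(k < K) (zone_end k - zone_start k) <= p + 18 * r.
  case: K hK minK => [|K] hK minK; first by rewrite big_ord0.
  have hp : zone_start K <= p by rewrite leqNgt; apply/negP => /minK; rewrite ltnn.
  have := free_notin_zone K fp; rewrite /in_zone hp -leqNgt /= => he.
  have ht : tower K <= r.
    by move: hp; rewrite /zone_start; have := tower_gt K; nia.
  have := sum_zone_length K; rewrite big_ord_recr /=.
  by have := tower_gt K; move: he; rewrite /zone_end; lia.
suff : p <= nfree p + r.+1 + \sum_(k < K) (zone_end k - zone_start k) by lia.
have {1}<- : \sum_(s < p) 1 = p by rewrite sum1_card card_ord.
(* Each position is free, a square or in a zone; the bound follows by summing over positions and
   exchanging sums. *)
have hpt (s : 'I_p) : 1 <= is_free s + \sum_(t < r.+1) (t ^ 2 <= s < (t ^ 2).+1) +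
    \sum_(k < K) in_zone k s.
  case fs : (is_free s) => //=; rewrite add0n addn_gt0 !lt0n !sum_nat_eq0 !negb_forall.
  move/negbT: fs; rewrite negb_and !negbK => /orP[/is_squareP[t e]|/zoneP[k hk]].
    have tr : t < r.+1 by have := ltn_ord s; case: (ltnP t r.+1) => // h; nia.
    apply/orP; left; apply/existsP; exists (Ordinal tr) => /=.
    by rewrite e leqnn ltnSn.
  have kK : k < K.
    case: (ltnP k K) => // /zone_start_homo h.
    by move: hk; rewrite /in_zone; have := ltn_ord s; lia.
  by apply/orP; right; apply/existsP; exists (Ordinal kK) => /=; rewrite hk.
apply: leq_trans; first by apply: leq_sum => s _; exact: hpt.
rewrite !big_split /= -/(nfree p); apply: leq_add; first apply: leq_add => //.
  rewrite exchange_big /=; rewrite -[X in _ <= X]card_ord -sum1_card.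
  by apply: leq_sum => t _; apply: leq_trans (sum_itv_le _ _ _) _; lia.
by rewrite exchange_big; apply: leq_sum => k _; exact: sum_itv_le.
Qed.

Lemma sqrt_ex p : exists r, r ^ 2 <= p < r.+1 ^ 2.
Proof.
have ex : exists r, p < r ^ 2 by exists p.+1; nia.
have [[|r] hr minr] := ex_minnP ex; first by lia.
by exists r; rewrite hr andbT leqNgt; apply/negP => /minr; rewrite ltnn.
Qed.

End Positions.

(** * Binary expansions and their real values *)

Section Binary.
Variable R : realType.
Implicit Types (e : nat -> bool) (P Q : nat).

Definition bpart e P : R := \sum_(p < P) (e p)%:R / 2 ^+ p.+1.
Definition bval e : R := sup (range (bpart e)).

Lemma expr2_gt0 P : 0 < (2 : R) ^+ P. Proof. exact: exprn_gt0. Qed.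

Lemma expr2V_gt0 P : 0 < ((2 : R) ^+ P)^-1.
Proof. by rewrite invr_gt0 expr2_gt0. Qed.

Lemma expr2VS P : ((2 : R) ^+ P.+1)^-1 = (2 ^+ P)^-1 / 2.
Proof. by rewrite exprS invfM mulrC. Qed.

Lemma expr2V_le P Q : (P <= Q)%N -> ((2 : R) ^+ Q)^-1 <= (2 ^+ P)^-1.
Proof. by move=> PQ; rewrite lef_pV2 ?posrE ?expr2_gt0 // ler_weXn2l // ler1n. Qed.

Lemma expr2V_arch (x : R) : 0 < x -> exists P, (2 ^+ P)^-1 < x.
Proof.
move=> x0; exists (Num.truncn x^-1).+1.
rewrite invf_plt ?posrE ?expr2_gt0 //.
apply: lt_trans (truncnS_gt _) _; rewrite -natrX ltr_nat.
exact: ltn_expl.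
Qed.

Lemma bpartS e P : bpart e P.+1 = bpart e P + (e P)%:R / 2 ^+ P.+1.
Proof. by rewrite /bpart big_ord_recr. Qed.

Lemma bpart_le e P Q : (P <= Q)%N -> bpart e P <= bpart e Q.
Proof.
move=> PQ; rewrite -(subnK PQ); elim: (Q - P)%N => [|m ih]; first by [].
by rewrite addSn bpartS (le_trans ih) // lerDl divr_ge0 // ler0n.
Qed.

(** The next digit adds at most half of the remaining length [2 ^- P], so the dyadic intervals
    starting at [bpart e P] are nested. *)
Lemma bpart_tail e P Q : (P <= Q)%N ->
  bpart e Q + (2 ^+ Q)^-1 <= bpart e P + (2 ^+ P)^-1.
Proof.
move=> PQ; rewrite -(subnK PQ); elim: (Q - P)%N => [|m ih]; first by [].
rewrite addSn; apply: le_trans ih; rewrite bpartS expr2VS.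
have := expr2V_gt0 (m + P); set z := (_)^-1.
by case: (e _) => /= z0; rewrite ?mul0r; lra.
Qed.

Lemma bpart_has_sup e : has_sup (range (bpart e)).
Proof.
split; first by exists (bpart e 0); exists 0%N.
exists (bpart e 0 + 1) => _ [P _ <-].
have := @bpart_tail e 0 P (leq0n _); rewrite expr0 invr1.
by have := expr2V_gt0 P; lra.
Qed.

Lemma bpart_bval e P : bpart e P <= bval e.
Proof. by apply: ub_le_sup; [case: (bpart_has_sup e) | exists P]. Qed.

Lemma bval_bpart e P : bval e <= bpart e P + (2 ^+ P)^-1.
Proof.
apply: ge_sup; first by case: (bpart_has_sup e).
move=> _ [Q _ <-]; have [PQ|QP] := leqP P Q.
  by have := @bpart_tail e _ _ PQ; have := expr2V_gt0 Q; lra.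
by have := @bpart_le e _ _ (ltnW QP); have := expr2V_gt0 P; lra.
Qed.

Lemma bpart0 e : bpart e 0 = 0. Proof. by rewrite /bpart big_ord0. Qed.

Lemma bval_ge0 e : 0 <= bval e.
Proof. by have := bpart_bval e 0; rewrite bpart0. Qed.

Lemma bval_le1 e : bval e <= 1.
Proof. by have := bval_bpart e 0; rewrite bpart0 expr0 invr1 add0r. Qed.

Lemma bpart_eq e e' P : (forall p, (p < P)%N -> e p = e' p) -> bpart e P = bpart e' P.
Proof. by move=> h; apply: eq_bigr => p _; rewrite h. Qed.

Lemma bval_near e e' P : (forall p, (p < P)%N -> e p = e' p) ->
  `|bval e - bval e'| <= (2 ^+ P)^-1.
Proof.
move=> /bpart_eq h; have := bpart_bval e P; have := bpart_bval e' P.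
have := bval_bpart e P; have := bval_bpart e' P; rewrite h ler_norml.
by move=> *; apply/andP; split; lra.
Qed.

Lemma bpart_zero e P Q : (P <= Q)%N ->
  (forall p, (P <= p < Q)%N -> e p = false) -> bpart e Q = bpart e P.
Proof.
move=> PQ; rewrite -(subnK PQ); elim: (Q - P)%N => [//|m ih] h.
rewrite addSn bpartS ih ?h ?mul0r ?addr0 //; first by lia.
by move=> p hp; apply: h; lia.
Qed.

Lemma bpart_nat e P : exists m : nat, bpart e P = m%:R / 2 ^+ P.
Proof.
elim: P => [|P [m ih]]; first by exists 0%N; rewrite bpart0 mul0r.
exists (m * 2 + e P)%N; rewrite bpartS ih natrD natrM exprS.
by field; rewrite expf_neq0 // pnatr_eq0.
Qed.

(* The common zero digit [q] prevents a carry from cancelling the difference at [p]. *)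
Lemma bval_sep_lt e e' p q : (p < q)%N -> (forall r, (r < p)%N -> e r = e' r) ->
  e p = true -> e' p = false -> e' q = false ->
  (2 ^+ q.+1)^-1 <= bval e - bval e'.
Proof.
move=> pq /bpart_eq h ep ep' eq'.
have := bpart_bval e p.+1; have := bval_bpart e' q.+1.
have := @bpart_tail e' _ _ pq; rewrite !bpartS ep ep' eq' h !expr2VS /= !mul0r mul1r.
by have := expr2V_gt0 q; have := expr2V_gt0 p; lra.
Qed.

Lemma bval_sep e e' p q : (p < q)%N -> (forall r, (r < p)%N -> e r = e' r) ->
  e p != e' p -> e q = false -> e' q = false ->
  (2 ^+ q.+1)^-1 <= `|bval e - bval e'|.
Proof.
move=> pq h; case ep: (e p); case ep': (e' p) => // _ eq eq'.
  by apply: le_trans (ler_norm _); apply: (@bval_sep_lt _ _ p).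
rewrite distrC; apply: le_trans (ler_norm _); apply: (@bval_sep_lt _ _ p) => //.
by move=> r /h.
Qed.

(** Digit [p] is the parity of the integer part of [2 ^ p.+1 * t]; the partial sums are then the
    dyadic truncations of [t]. *)
Lemma bval_surj (t : R) : 0 <= t < 1 -> exists e, bval e = t.
Proof.
move=> /andP[t0 t1]; pose e p := odd (Num.truncn (2 ^+ p.+1 * t)).
have hP P : bpart e P = (Num.truncn (2 ^+ P * t))%:R / 2 ^+ P.
  elim: P => [|P ih].
    rewrite bpart0 expr0 mul1r; suff -> : Num.truncn t = 0%N by rewrite mul0r.
    by apply/eqP; rewrite truncn_eq // t0 t1.
  rewrite bpartS ih /e; set m := Num.truncn (2 ^+ P * t).
  set m' := Num.truncn (2 ^+ P.+1 * t).
  have /andP[h1 h2] : m%:R <= 2 ^+ P * t < m.+1%:R.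
    by apply: truncn_itv; rewrite mulr_ge0 // ltW // expr2_gt0.
  have /andP[h3 h4] : m'%:R <= 2 ^+ P.+1 * t < m'.+1%:R.
    by apply: truncn_itv; rewrite mulr_ge0 // ltW // expr2_gt0.
  (* Doubling a number doubles its integer part, up to adding 1, and the parity records which case
     occurs. *)
  have e' : m' = (m * 2 + odd m')%N.
    have a : (m' < 2 * m + 2)%N.
      rewrite -(ltr_nat R); apply: le_lt_trans h3 _; rewrite exprS natrD natrM.
      by move: h2; rewrite -natr1; lra.
    have b : (2 * m < m' + 1)%N.
      rewrite -(ltr_nat R) addn1; apply: le_lt_trans h4; rewrite exprS natrM.
      by move: h1; lra.
    by have := odd_double_half m'; lia.
  rewrite {2}e' natrD natrM exprS; move: (odd m')%:R m%:R => u v.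
  by field; rewrite expf_neq0 // pnatr_eq0.
exists e; apply/eqP; rewrite -subr_eq0 -normr_le0 leNgt; apply/negP.
move=> /expr2V_arch[P]; apply/negP; rewrite -leNgt.
have := bpart_bval e P; have := bval_bpart e P; rewrite hP.
have /andP[h1 h2] : (Num.truncn (2 ^+ P * t))%:R <= 2 ^+ P * t
    < (Num.truncn (2 ^+ P * t)).+1%:R.
  by apply: truncn_itv; rewrite mulr_ge0 // ltW // expr2_gt0.
have {}h1 : (Num.truncn (2 ^+ P * t))%:R / 2 ^+ P <= t.
  by rewrite ler_pdivrMr ?expr2_gt0 // [leRHS]mulrC.
have {}h2 : t < (Num.truncn (2 ^+ P * t))%:R / 2 ^+ P + (2 ^+ P)^-1.
  by rewrite -[X in _ + X]mul1r -mulrDl natr1 ltr_pdivlMr ?expr2_gt0 // [ltLHS]mulrC.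
by move=> *; rewrite ler_norml; apply/andP; split; lra.
Qed.

End Binary.

(** * Digits determined by an infinite binary word *)

Section Digits.
Local Open Scope nat_scope.
Implicit Types (w : nat -> bool) (n i k p m : nat).

(* The third component makes every pair (word, coordinate) occur at infinitely
   many stages [k]. *)
Definition shift_bit i k w : bool :=
  if (unpickle k : option (seq bool * nat * nat)) is Some (s, j, _) then
    [&& j == i, size s <= k & mkseq w (size s) == s]
  else false.

(** The [n] coordinates read the same word in interleaved order, each free position consuming one
    block of [n] letters. *)
Definition digit n i w p : bool :=
  if is_free p then w (nfree p * n + i)
  else [exists k : 'I_p.+1, (p == shift_pos k) && shift_bit i k w].

Lemma digit_nfree n i w p : ~~ is_free p -> digit n i w p ->
  exists2 k, p = shift_pos k & shift_bit i k w.
Proof.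
rewrite /digit => /negbTE-> /existsP[k /andP[/eqP e h]].
by exists k.
Qed.

Lemma digit_square n i w r : digit n i w (r ^ 2) = false.
Proof.
apply/negbTE/negP => /(digit_nfree (free_notsquare r))[k e _].
by have /is_squareP := shift_pos_nsquare k; apply; exists r.
Qed.

Lemma digit_zone n i w k p : in_zone k p -> p != shift_pos k ->
  digit n i w p = false.
Proof.
move=> hk /eqP hp; apply/negbTE/negP => h.
have /digit_nfree/(_ h)[j e _] : ~~ is_free p.
  by apply/negP => /(free_notin_zone k); rewrite hk.
by apply: hp; rewrite e; congr shift_pos; apply: (in_zone_inj _ hk); rewrite e in_zone_shift.
Qed.

Lemma digit_shift n i w k : digit n i w (shift_pos k) = shift_bit i k w.
Proof.
rewrite /digit; case fr : is_free.
  by have := free_notin_zone k fr; rewrite in_zone_shift.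
apply/existsP/idP => [[j /andP[/eqP/shift_pos_inj <-]]//|h].
have hk : k < (shift_pos k).+1 by rewrite /shift_pos; lia.
by exists (Ordinal hk); rewrite /= eqxx.
Qed.

Lemma eq_shift_bit i k w w' : (forall m, m < k -> w m = w' m) ->
  shift_bit i k w = shift_bit i k w'.
Proof.
move=> h; rewrite /shift_bit; case: unpickle => // -[[s j] _].
case: (leqP (size s) k) => sk; last by rewrite !andbF.
congr [&& _, _ & _ == _]; apply/eq_in_map => m; rewrite mem_iota add0n => /andP[_ hm].
by apply: h; exact: leq_trans sk.
Qed.

(** The shift digit of stage [k] reads only the first [k] letters, and
    [k <= nfree (zone_start k) <= nfree P] as soon as [shift_pos k < P]; so shifts do not look ahead
    of the free digits. *)
Lemma eq_digit n i w w' P : i < n ->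
  (forall m, m < nfree P * n -> w m = w' m) ->
  forall p, p < P -> digit n i w p = digit n i w' p.
Proof.
move=> hi h p pP; rewrite /digit; case fr : is_free.
  apply: h; have := nfree_homo pP; rewrite nfreeS fr => hP.
  by apply: leq_trans (leq_mul hP (leqnn n)); rewrite mulnDl; lia.
apply: eq_existsb => k; case: eqP => //= e; apply: eq_shift_bit => m mk.
apply: h; have : nfree (zone_start k) <= nfree P.
  by apply: nfree_homo; apply: leq_trans (ltnW pP); move: e; rewrite /shift_pos; lia.
by have := nfree_zone_start k; nia.
Qed.

(** A stage coding the prefix of length [L] of [w] selects [w] and rejects every word that differs
    from it on this prefix. *)
Lemma shift_bit_select i w (W : (nat -> bool) -> Prop) L K :
  (forall w', W w' -> exists2 m, m < L & w m != w' m) ->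
  exists2 k, K <= k & forall j, shift_bit j k w = (i == j) /\
    forall w', W w' -> shift_bit j k w' = false.
Proof.
move=> hW; pose code (t : nat) := pickle (mkseq w L, i, t).
(* Codes are injective in [t], so by the pigeonhole principle they cannot all stay below the
   bound. *)
have [t ht] : exists t, maxn K L <= code t.
  apply: contrapT => /forallNP h.
  have lt t : code t < maxn K L by rewrite ltnNge; apply/negP/h.
  pose f (t : 'I_(maxn K L).+1) := Ordinal (lt t).
  have : injective f.
    move=> t1 t2 /(congr1 val) /= /(pcan_inj pickleK) [] e; exact: val_inj.
  by move/leq_card; rewrite !card_ord ltnn.
exists (code t); first by apply: leq_trans ht; rewrite leq_maxl.
have hL : L <= code t by apply: leq_trans ht; rewrite leq_maxr.
move=> j; rewrite /shift_bit pickleK size_mkseq hL eqxx !andbT; split=> //.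
move=> w' /hW[m mL hm]; apply/negbTE; rewrite negb_and; apply/orP; right.
apply: contra hm => /eqP/(congr1 (fun s => nth false s m)).
by rewrite !nth_mkseq // => ->.
Qed.

End Digits.

(** * The points and their arithmetic at a fixed stage *)

Section Point.
Variables (R : realType) (n : nat).
Implicit Types (w : nat -> bool) (i j : 'I_n) (k : nat).

Definition point w : 'rV[R]_n := \row_i bval R (digit n i w).

Lemma pointE w i : point w ord0 i = bval R (digit n i w).
Proof. by rewrite mxE. Qed.

Lemma point_diff_le1 w w' i : `|point w ord0 i - point w' ord0 i| <= 1.
Proof.
rewrite !pointE ler_norml.
have := bval_ge0 R (digit n i w); have := bval_le1 R (digit n i w).
have := bval_ge0 R (digit n i w'); have := bval_le1 R (digit n i w').
by move=> *; apply/andP; split; lra.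
Qed.

Lemma point_near w w' P i : (forall m, (m < nfree P * n)%N -> w m = w' m) ->
  `|point w ord0 i - point w' ord0 i| <= (2 ^+ P)^-1.
Proof. by move=> h; rewrite !pointE; apply: bval_near; exact: eq_digit. Qed.

(** In coordinate [m %% n] the digits first differ at the free position [p] with [nfree p = m %/ n].
    The zero at the next square [r.+1 ^ 2] blocks carries, and [r.+1 ^ 2 <= p + 2 * r + 1] is
    bounded through [nfree_lower]. *)
Lemma point_sep w w' m : (0 < n)%N ->
  (forall l, (l < m)%N -> w l = w' l) -> w m != w' m ->
  exists r i, (r.+1 ^ 2 <= 2 * (m %/ n) + 22 * r + 3)%N /\
    (2 ^+ (r.+1 ^ 2).+1)^-1 <= `|point w ord0 i - point w' ord0 i|.
Proof.
move=> n_gt0 h hm; have [p fp ep] := free_pos_ex (m %/ n).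
have [r hr] := sqrt_ex p.
have mn : (m %% n < n)%N by rewrite ltn_mod.
exists r, (Ordinal mn); split; first by have := nfree_lower fp hr; lia.
rewrite !pointE; apply: (@bval_sep _ _ _ p); last 2 first.
- by rewrite digit_square.
- by rewrite digit_square.
- by case/andP: hr.
- move=> q qp; apply: eq_digit qp => // l hl; apply: h.
  by apply: leq_trans hl _; rewrite ep leq_trunc_div.
- by rewrite /digit fp ep /= -divn_eq.
Qed.

Lemma first_diff w w' : w <> w' ->
  exists2 m, w m != w' m & forall l, (l < m)%N -> w l = w' l.
Proof.
move=> ne; have ex : exists m, w m != w' m.
  apply: contrapT => /forallNP h; apply: ne; apply/funext => m.
  by apply/eqP; apply: contrapT => /negP/h.
have [m hm minm] := ex_minnP ex; exists m => // l lm.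
by apply/eqP; apply: contraTT lm => /minm; rewrite -leqNgt.
Qed.

Lemma point_inj : (0 < n)%N -> injective point.
Proof.
move=> n_gt0 w w' e; apply: contrapT => /first_diff[m hm h].
have [r [i [_]]] := point_sep n_gt0 h hm.
by rewrite e subrr normr0 leNgt expr2V_gt0.
Qed.

(** With [N = scale k], the shift digit is worth [theta k / N ^ 2], and all digits from [zone_end k]
    on are worth at most [eta k / N ^ 2]. *)
Definition scale k : R := 2 ^+ zone_start k.
Definition theta k : R := (2 ^+ k.+2)^-1.
Definition eta k : R := (2 ^+ k.+1.*2)^-1.

Lemma scale_gt0 k : 0 < scale k. Proof. exact: expr2_gt0. Qed.
Lemma theta_gt0 k : 0 < theta k. Proof. exact: expr2V_gt0. Qed.

(** The ratio of [eta k] to [theta k] tends to 0, which lets the shift dominate the error. *)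
Lemma etaE k : eta k = theta k * (2 ^+ k)^-1.
Proof. by rewrite /eta /theta -invfM -exprD; congr (_ ^+ _)^-1; lia. Qed.

Lemma scale2_int k : scale k ^+ 2 = (((2 ^+ zone_start k) ^+ 2 : int)%:~R).
Proof. by rewrite /scale !rmorphXn. Qed.

Lemma theta_exp k : theta k = (2 ^+ k.+2)^-1. Proof. by []. Qed.

Lemma eta_theta k : eta k <= theta k.
Proof. by apply: expr2V_le; lia. Qed.

Lemma theta_le k : theta k <= 4^-1.
Proof.
have := @expr2V_le R 2 k.+2 isT; rewrite -/(theta k).
by rewrite expr2 -natrM.
Qed.

Lemma scale2_eta k : (scale k ^+ 2)^-1 <= eta k.
Proof.
rewrite /scale -exprM; apply: expr2V_le.
by have := zone_start_gt k; lia.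
Qed.

(** Before the zone the expansion is a multiple of [1 / N], inside it only the shift digit can be
    nonzero, and the tail after it is [d / N ^ 2]. *)
Lemma point_stage w i k : exists (A : nat) (d : R), [/\ 0 <= d, d <= eta k &
  point w ord0 i = A%:R / scale k +
    ((shift_bit i k w)%:R * theta k + d) / scale k ^+ 2].
Proof.
pose e := digit n i w.
have [A eA] := bpart_nat R e (zone_start k).
have h1 : bpart R e (shift_pos k) = bpart R e (zone_start k).
  apply: bpart_zero => [|p hp]; first by rewrite /shift_pos; lia.
  by apply: (@digit_zone _ _ _ k); rewrite /in_zone /zone_end; move: hp; rewrite /shift_pos; lia.
have h2 : bpart R e (zone_end k) = bpart R e (shift_pos k).+1.
  apply: bpart_zero => [|p hp]; first by rewrite /shift_pos /zone_end; lia.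
  by apply: (@digit_zone _ _ _ k); rewrite /in_zone; move: hp; rewrite /shift_pos; lia.
have h3 : bpart R e (zone_end k) =
    A%:R / scale k + (shift_bit i k w)%:R * theta k / scale k ^+ 2.
  rewrite h2 bpartS h1 eA /e digit_shift -mulrA; congr (_ + _ * _).
  by rewrite /theta /scale -exprM -invfM -exprD; congr (_ ^+ _)^-1; rewrite /shift_pos; lia.
exists A, ((bval R e - bpart R e (zone_end k)) * scale k ^+ 2).
have s0 : 0 < scale k ^+ 2 by rewrite exprn_gt0 // scale_gt0.
split.
- by rewrite mulr_ge0 // ?(ltW s0) // subr_ge0 bpart_bval.
- have -> : eta k = (2 ^+ zone_end k)^-1 * scale k ^+ 2.
    have -> : (2 : R) ^+ zone_end k = scale k ^+ 2 * 2 ^+ k.+1.*2.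
      by rewrite /scale -exprM -exprD mulnC.
    by rewrite invfM mulrC mulVKf // gt_eqF.
  by rewrite ler_pM2r // lerBlDl bval_bpart.
- rewrite pointE -/e mulrDl mulfK ?gt_eqF // addrA -h3; lra.
Qed.

(* [u] is a coordinate difference at stage [k]: a lattice part, [c] times the
   shift, and a much smaller error. *)
Definition stage_diff k (c u : R) := [/\ `|u| <= 1, `|c| <= 1 & exists (U : int) (d : R),
  `|d| <= eta k /\ u = U%:~R / scale k + (c * theta k + d) / scale k ^+ 2].

Lemma point_stage_diff w w' i k : stage_diff k
  ((shift_bit i k w)%:R - (shift_bit i k w')%:R) (point w ord0 i - point w' ord0 i).
Proof.
split; first exact: point_diff_le1.
  by case: shift_bit; case: shift_bit; rewrite /= ?subrr ?subr0 ?sub0r ?normrN ?normr1 ?normr0.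
have [A [d [d0 d1 ->]]] := point_stage w i k.
have [A' [d' [d0' d1' ->]]] := point_stage w' i k.
exists (A%:Z - A'%:Z), (d - d'); split.
  by rewrite ler_norml; apply/andP; split; lra.
by rewrite intrB -!pmulrn; lra.
Qed.

(** Writing [u = U / N + T / N ^ 2] with [T = c * theta k + d], and likewise for [u'], one has [N ^
    2 * u * u' = U * U' + u * T' + u' * T - T * T' / N ^ 2]. The error consists of [u * d'],
    [u' * d] and the last term, each at most [eta k]. *)
Lemma stage_diff_mul k c c' u u' : stage_diff k c u -> stage_diff k c' u' ->
  exists m : int, `|scale k ^+ 2 * (u * u') - m%:~R - theta k * (c' * u + c * u')|
    <= 3 * eta k.
Proof.
move=> [u1 c1 [U [d [hd eu]]]] [u1' c1' [U' [d' [hd' eu']]]].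
have s0 := scale_gt0 k; exists (U * U').
set T := c * theta k + d; set T' := c' * theta k + d'.
have -> : scale k ^+ 2 * (u * u') - (U * U')%:~R - theta k * (c' * u + c * u') =
    u * d' + u' * d - T * T' / scale k ^+ 2.
  have eT' : theta k * c' = T' - d' by rewrite /T'; ring.
  have eT : theta k * c = T - d by rewrite /T; ring.
  rewrite mulrDr !mulrA eT eT' intrM eu eu' -/T -/T'.
  by field; rewrite gt_eqF.
have hth := theta_le k; have hth0 := theta_gt0 k; have he := eta_theta k.
have hT : `|T| <= 1.
  apply: le_trans (ler_normD _ _) _; rewrite normrM (gtr0_norm hth0).
  have : `|c| * theta k <= 1 * theta k by rewrite ler_pM2r.
  by lra.
have hT' : `|T'| <= 1.
  apply: le_trans (ler_normD _ _) _; rewrite normrM (gtr0_norm hth0).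
  have : `|c'| * theta k <= 1 * theta k by rewrite ler_pM2r.
  by lra.
have h1 : `|u * d'| <= eta k by rewrite normrM -[leRHS]mul1r ler_pM.
have h2 : `|u' * d| <= eta k by rewrite normrM -[leRHS]mul1r ler_pM.
have h3 : `|T * T' / scale k ^+ 2| <= eta k.
  rewrite normrM; apply: le_trans (scale2_eta k).
  have s2 : 0 < (scale k ^+ 2)^-1 by rewrite invr_gt0 exprn_gt0.
  rewrite (gtr0_norm s2) ler_piMl ?(ltW s2) //.
  by rewrite normrM -[leRHS]mul1r ler_pM.
apply: le_trans (ler_normB _ _) _.
by have := ler_normD (u * d') (u' * d); lra.
Qed.

Lemma eucl_dist_sqr (x y : 'rV[R]_n) :
  eucl_dist x y ^+ 2 = \sum_i (x ord0 i - y ord0 i) ^+ 2.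
Proof.
rewrite /eucl_dist /eucl_norm sqr_sqrtr; last by apply: sumr_ge0 => i _; exact: sqr_ge0.
by apply: eq_bigr => i _; rewrite !mxE.
Qed.

Lemma eucl_dist_stage k w w' (c : 'I_n -> R) :
  (forall i, c i = (shift_bit i k w)%:R - (shift_bit i k w')%:R) ->
  exists m : int, `|scale k ^+ 2 * eucl_dist (point w) (point w') ^+ 2 - m%:~R -
    2 * theta k * \sum_i c i * (point w ord0 i - point w' ord0 i)| <= n%:R * (3 * eta k).
Proof.
move=> hc; rewrite eucl_dist_sqr.
have h i : exists m : int, `|scale k ^+ 2 * (point w ord0 i - point w' ord0 i) ^+ 2 -
    m%:~R - 2 * theta k * (c i * (point w ord0 i - point w' ord0 i))| <= 3 * eta k.
  have [m hm] := stage_diff_mul (point_stage_diff w w' i k) (point_stage_diff w w' i k).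
  exists m; move: hm; rewrite -hc expr2; congr (`|_| <= _); ring.
have [m hm] := choice h.
exists (\sum_i m i); rewrite rmorph_sum /= !mulr_sumr -!sumrB.
apply: le_trans (ler_norm_sum _ _ _) _.
apply: le_trans (_ : \sum_(i < n) 3 * eta k <= _); first exact: ler_sum.
by rewrite sumr_const card_ord -[leLHS]mulr_natl.
Qed.

End Point.

Opaque scale theta eta.

Lemma int_small_eq0 (R : realType) (m : int) (e d : R) :
  `|m%:~R + e| <= d -> `|e| + d < 1 -> m = 0.
Proof.
move=> h1 h2; suff : `|m| < 1 by lia.
rewrite -(ltr_int R) intr_norm.
have := ler_normB (m%:~R + e) e; rewrite addrK; lra.
Qed.

(** * Excluding coincidences by selecting a stage *)

Section Avoidance.
Variables (R : realType) (n : nat).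
Hypothesis n_gt0 : (0 < n)%N.
Implicit Types (w : nat -> bool) (i j : 'I_n) (k : nat).

Lemma stage_select i w (W : seq (nat -> bool)) K : (forall v, List.In v W -> w <> v) ->
  exists2 k, (K <= k)%N & forall j, shift_bit j k w = (i == j) /\
    forall v, List.In v W -> shift_bit j k v = false.
Proof.
move=> hW; have [L hL] : exists L, forall v, List.In v W -> exists2 m, (m < L)%N & w m != v m.
  elim: W hW => [|v W ih] hW; first by exists 0%N.
  have [L hL] := ih (fun v' hv' => hW v' (or_intror hv')).
  have [m hm _] := first_diff (hW v (or_introl erefl)).
  exists (maxn L m.+1) => v' [<-|/hL[m' hm' h]]; first by exists m => //; lia.
  by exists m' => //; lia.
have [k Kk hk] := @shift_bit_select i w (fun v => List.In v W) L K hL.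
by exists k => // j; exact: hk.
Qed.

Lemma expr2V_lt_later (x : R) : 0 < x ->
  exists K, forall k, (K <= k)%N -> (2 ^+ k)^-1 < x.
Proof.
move=> /expr2V_arch[K hK]; exists K => k Kk.
exact: le_lt_trans (expr2V_le _ Kk) hK.
Qed.

Lemma expr2V_itv k : 0 <= ((2 : R) ^+ k)^-1 <= 1.
Proof.
apply/andP; split; first exact: ltW (expr2V_gt0 R k).
by have := @expr2V_le R 0 k isT; rewrite expr0 invr1.
Qed.

Lemma sum_single i (f : 'I_n -> R) : \sum_j (i == j)%:R * f j = f i.
Proof.
rewrite (bigD1 i) //= eqxx mul1r big1 ?addr0 // => j ji.
by rewrite eq_sym (negbTE ji) mul0r.
Qed.

(* Multiplying by [b S] makes everything integral up to the term [2 b th u] and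
   an error which is smaller by the factor [x]; hence that term is small as well. *)
Lemma shift_bound_dist (S D1 D2 th x u N b : R) (z a b' m1 m2 : int) :
  S = z%:~R -> b = b'%:~R -> 1 <= N -> 1 <= b -> 0 < th -> 0 <= x <= 1 -> `|u| <= 1 ->
  8 * (N * b) * th < 1 -> b * (D1 - D2) = a%:~R ->
  `|S * D1 - m1%:~R - 2 * th * u| <= N * (3 * (th * x)) ->
  `|S * D2 - m2%:~R| <= N * (3 * (th * x)) ->
  `|u| <= 3 * N * x.
Proof.
move=> eS eb N1 b1 th0 /andP[x0 x1] u1 small e h1 h2.
have N0 : 0 < N by lra.
have b0 : 0 < b by lra.
(* [M] is the integer left in [b * ((S * D2 - m2) - (S * D1 - m1))] once [b * (D1 - D2)] is replaced
   by [a]. *)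
pose M : int := b' * (m1 - m2) - z * a.
have eM : M%:~R = b * (m1%:~R - m2%:~R) - S * (b * (D1 - D2)) :> R.
  by rewrite e /M intrB !intrM intrB eS eb.
have hM : `|M%:~R + b * (2 * th * u)| <= b * (2 * (N * (3 * (th * x)))).
  have -> : M%:~R + b * (2 * th * u) =
    b * ((S * D2 - m2%:~R) - (S * D1 - m1%:~R - 2 * th * u)) by rewrite eM; ring.
  rewrite normrM (gtr0_norm b0) ler_pM2l //.
  by apply: le_trans (ler_normB _ _) _; lra.
have bth : 0 < b * (2 * th) by rewrite !mulr_gt0.
have ebu : `|b * (2 * th * u)| = b * (2 * th) * `|u|.
  by rewrite mulrA normrM (gtr0_norm bth).
have M0 : M = 0.
  (* The shift term is at most [2 * b * th] and the error at most [6 * N * b * th], together at most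
     [8 * N * b * th < 1]. *)
  apply: int_small_eq0 hM _; rewrite ebu.
  have hu : b * (2 * th) * `|u| <= b * (2 * th) * 1 by rewrite ler_pM2l.
  have hN : b * th * 1 <= b * th * N by rewrite ler_pM2l // mulr_gt0.
  have hx : b * th * N * x <= b * th * N * 1 by rewrite ler_pM2l // !mulr_gt0.
  by lra.
move: hM; rewrite M0 add0r ebu.
have -> : b * (2 * (N * (3 * (th * x)))) = b * (2 * th) * (3 * N * x) by ring.
by rewrite ler_pM2l.
Qed.

(** Here [S] is one number with two descriptions: near an integer plus [th * u], and near an
    integer. Their difference forces the integers to agree. *)
Lemma shift_bound_prod (S th x u : R) (m1 m2 : int) :
  0 < th -> 0 <= x <= 1 -> `|u| <= 1 -> 8 * th < 1 ->
  `|S - m1%:~R - th * u| <= 3 * (th * x) -> `|S - m2%:~R| <= 3 * (th * x) ->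
  `|u| <= 6 * x.
Proof.
move=> th0 /andP[x0 x1] u1 small h1 h2.
have etu : `|th * u| = th * `|u| by rewrite normrM (gtr0_norm th0).
have hM : `|(m1 - m2)%:~R + th * u| <= 6 * (th * x).
  have -> : (m1 - m2)%:~R + th * u = (S - m2%:~R) - (S - m1%:~R - th * u).
    by rewrite intrB; ring.
  by apply: le_trans (ler_normB _ _) _; lra.
have hu : th * `|u| <= th * 1 by rewrite ler_pM2l.
have hx : th * x <= th * 1 by rewrite ler_pM2l.
have M0 : m1 - m2 = 0 by apply: int_small_eq0 hM _; rewrite etu; lra.
by move: hM; rewrite M0 add0r etu mulrCA ler_pM2l.
Qed.

(** Covers two uses: [a = 0], [b = 1] for repeated distances, and [wz = wv] for rational
    distances. *)
Lemma dist_diff_irrational w wy wz wv (a : int) (b : nat) : (0 < b)%N ->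
  w <> wy -> w <> wz -> w <> wv ->
  b%:R * (eucl_dist (point R n w) (point R n wy) ^+ 2 -
    eucl_dist (point R n wz) (point R n wv) ^+ 2) <> a%:~R.
Proof.
move=> b0 hy hz hv e.
have [i hi] : exists i, point R n w ord0 i != point R n wy ord0 i.
  apply: contrapT => /forallNP h; apply: hy; apply: (@point_inj R n n_gt0).
  by apply/rowP => i; apply/eqP; apply: contrapT => /negP/h.
set u := point R n w ord0 i - point R n wy ord0 i.
have u0 : 0 < `|u| by rewrite normr_gt0 subr_eq0.
have n1 : 1 <= n%:R :> R by rewrite ler1n.
have b1 : 1 <= b%:R :> R by rewrite ler1n.
have nb0 : 0 < n%:R * b%:R :> R by rewrite mulr_gt0 // ltr0n.
(* The first threshold gives the smallness of [theta] required by [shift_bound_dist]; the second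
   makes its conclusion contradict [u <> 0]. *)
have [K hK] := @expr2V_lt_later (Num.min (8 * (n%:R * b%:R))^-1 (`|u| / (3 * n%:R)))
  ltac:(by rewrite lt_min invr_gt0 divr_gt0 ?mulr_gt0 // ltr0n).
have [k /hK hk sel] : exists2 k, (K <= k)%N & forall j, shift_bit j k w = (i == j) /\
    forall v, List.In v [:: wy; wz; wv] -> shift_bit j k v = false.
  by apply: stage_select => v /= [<-|[<-|[<-|//]]].
move: hk; rewrite lt_min => /andP[hk1 hk2].
have hW v : List.In v [:: wy; wz; wv] -> forall j, shift_bit j k v = false.
  by move=> hv' j; case: (sel j) => _; apply.
have [m1 h1] := @eucl_dist_stage R n k w wy (fun j => (i == j)%:R)
  ltac:(by move=> j; rewrite (sel j).1 (hW wy) ?subr0 //; left).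
have [m2 h2] := @eucl_dist_stage R n k wz wv (fun=> 0)
  ltac:(by move=> j; rewrite (hW wz) ?(hW wv) ?subrr //=; tauto).
cbv beta in h1, h2.
have s0 : \sum_j 0 * (point R n wz ord0 j - point R n wv ord0 j) = 0.
  by apply: big1 => j _; rewrite mul0r.
rewrite s0 mulr0 subr0 etaE in h2.
rewrite sum_single -/u etaE in h1.
have x01 := expr2V_itv k.
have small : 8 * (n%:R * b%:R) * theta R k < 1.
  have c0 : 0 < 8 * (n%:R * b%:R) :> R by rewrite mulr_gt0.
  rewrite mulrC -ltr_pdivlMr // div1r; apply: le_lt_trans hk1.
  by rewrite theta_exp; exact: (@expr2V_le R k k.+2 (leqW (leqnSn k))).
have := shift_bound_dist (scale2_int R k) (pmulrn 1 b) n1 b1 (theta_gt0 R k) x01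
  (point_diff_le1 R w wy i) small e h1 h2.
rewrite leNgt => /negP; apply.
by move: hk2; rewrite ltr_pdivlMr ?mulr_gt0 ?ltr0n // [X in X < _ -> _]mulrC.
Qed.

(** At a stage shifting only coordinate [i] of [w], the left product acquires [theta] times the
    [j]th difference of the last two points, while the right product acquires no shift because
    [i != j]. That difference is thus at most [6 * 2 ^- k] for arbitrarily late [k]. *)
Lemma direction_unique w wy wz wv i j : i != j ->
  w <> wy -> w <> wz -> w <> wv ->
  (point R n w ord0 i - point R n wy ord0 i) * (point R n wz ord0 j - point R n wv ord0 j) =
  (point R n w ord0 j - point R n wy ord0 j) * (point R n wz ord0 i - point R n wv ord0 i) ->
  point R n wz ord0 j = point R n wv ord0 j.
Proof.
move=> ij hy hz hv e.
apply/eqP; rewrite -subr_eq0 -normr_le0 leNgt; apply/negP => u0.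
have [K hK] := @expr2V_lt_later
  (Num.min 8^-1 (`|point R n wz ord0 j - point R n wv ord0 j| / 6))
  ltac:(by rewrite lt_min invr_gt0 ltr0n divr_gt0).
have [k /hK hk sel] : exists2 k, (K <= k)%N & forall j, shift_bit j k w = (i == j) /\
    forall v, List.In v [:: wy; wz; wv] -> shift_bit j k v = false.
  by apply: stage_select => v /= [<-|[<-|[<-|//]]].
move: hk; rewrite lt_min => /andP[hk1 hk2].
have hW v : List.In v [:: wy; wz; wv] -> forall j, shift_bit j k v = false.
  by move=> hv' j'; case: (sel j') => _; apply.
have st j' : stage_diff k (i == j')%:R (point R n w ord0 j' - point R n wy ord0 j').
  have := point_stage_diff R w wy j' k.
  by rewrite (sel j').1 (hW wy) ?subr0 //; left.
have st' j' : stage_diff k 0 (point R n wz ord0 j' - point R n wv ord0 j').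
  have := point_stage_diff R wz wv j' k.
  rewrite (hW wz (or_intror (or_introl erefl))).
  by rewrite (hW wv (or_intror (or_intror (or_introl erefl)))) subrr.
have [m1 h1] := stage_diff_mul (st i) (st' j).
have [m2 h2] := stage_diff_mul (st j) (st' i).
rewrite eqxx mul0r mul1r add0r etaE in h1.
rewrite -e (negbTE ij) !mul0r addr0 mulr0 subr0 etaE in h2.
have x01 := expr2V_itv k.
have small : 8 * theta R k < 1.
  rewrite mulrC -ltr_pdivlMr // div1r; apply: le_lt_trans hk1.
  by rewrite theta_exp; exact: (@expr2V_le R k k.+2 (leqW (leqnSn k))).
have := shift_bound_prod (theta_gt0 R k) x01 (point_diff_le1 R wz wv j) small h1 h2.
by rewrite leNgt mulrC -ltr_pdivlMr // hk2.
Qed.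

End Avoidance.

(** * Null sets of reals whose scaled squares are near integers *)

Section NullSets.
Variable R : realType.

(** Applies to arbitrary sets, the value on any set being its outer measure. *)
Lemma lebesgue_measure_mono (A B : set R) : A `<=` B ->
  (lebesgue_measure A <= lebesgue_measure B)%E.
Proof.
by move=> AB; rewrite /lebesgue_measure /lebesgue_stieltjes_measure; exact: le_mu_ext.
Qed.

Lemma lebesgue_measure_ge0 (A : set R) : (0 <= lebesgue_measure A)%E.
Proof. by apply: mu_ext_ge0 => X; exact: wlength_ge0. Qed.

Lemma small_diam_cover (A : set R) (r : R) : 0 <= r ->
  (forall x y, A x -> A y -> `|x - y| <= r) ->
  exists B : set R, [/\ A `<=` B, measurable B & (lebesgue_measure B <= (2 * r)%:E)%E].
Proof.
move=> r0 hA; have [[x Ax]|A0] := pselect (exists x, A x); last first.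
  exists set0; rewrite measure0 lee_fin mulr_ge0 //; split => // x Ax.
  by exfalso; apply: A0; exists x.
exists `[x - r, x + r]%classic; split.
- move=> y Ay /=; rewrite in_itv /=.
  by have := hA _ _ Ay Ax; rewrite ler_norml => /andP[*]; apply/andP; split; lra.
- exact: measurable_itv.
- rewrite lebesgue_measure_itv /=; case: ifPn => _.
    by rewrite -EFinB lee_fin; lra.
  by rewrite lee_fin mulr_ge0.
Qed.

(** Elements above [e] whose scaled squares are near the same integer differ by at most [e / S].
    About [S * B] integers occur, so the total length is [O(e)], and the elements below [e] lie in
    [[0, e]]. *)
Lemma null_near_integers (D : set R) (B : R) :
  (forall d, D d -> 0 <= d /\ d ^+ 2 <= B) ->
  (forall delta, 0 < delta -> exists2 S, 1 <= S &
     forall d, D d -> exists m : int, `|S * d ^+ 2 - m%:~R| <= delta) ->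
  lebesgue_measure D = 0%E.
Proof.
move=> hD hS; apply/eqP; rewrite eq_le lebesgue_measure_ge0 andbT.
wlog B0 : B hD / 0 <= B.
  move=> h; apply: (h (Num.max B 0)) => [d /hD[d0 dB]|]; last by rewrite le_max lexx orbT.
  by split=> //; rewrite le_max dB.
apply/lee_addgt0Pr => e0 e00; rewrite add0e.
(* The final bound is [e + (S * B + 2) * (2 * e / S) <= e * (2 * B + 5)]; [e <= 1/2] gives
   [e ^ 2 < 1], which excludes negative integers. *)
pose e : R := Num.min (2^-1) (e0 / (2 * B + 5)).
have e_gt0 : 0 < e by rewrite lt_min invr_gt0 ltr0n divr_gt0 //; lra.
have e_half : e <= 2^-1 by rewrite ge_min lexx.
have e_e0 : e * (2 * B + 5) <= e0.
  by rewrite -ler_pdivlMr; [rewrite ge_min lexx orbT | lra].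
have [S S1 hd] := hS (e ^+ 2) (exprn_gt0 _ e_gt0).
have S0 : 0 < S by lra.
have ee : e ^+ 2 < 1 by rewrite expr_lt1 //; lra.
pose r := e / S; have r0 : 0 <= r by rewrite divr_ge0 // ltW.
pose M := (Num.truncn (S * B + 1)).+1.
pose A (m : nat) := [set d | [/\ D d, e <= d & `|S * d ^+ 2 - m%:R| <= e ^+ 2]].
have step m : exists C : set R,
    [/\ A m `<=` C, measurable C & (lebesgue_measure C <= (2 * r)%:E)%E].
  apply: small_diam_cover => // x y [_ ex hx] [_ ey hy].
  have hxy : S * (2 * e) * `|x - y| <= 2 * e ^+ 2.
    have -> : 2 * e ^+ 2 = e ^+ 2 + e ^+ 2 by ring.
    apply: le_trans (lerD hx hy); apply: le_trans (ler_normB _ _).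
    have -> : S * x ^+ 2 - m%:R - (S * y ^+ 2 - m%:R) = S * (x + y) * (x - y) by ring.
    rewrite normrM (@gtr0_norm _ (S * _)) ?mulr_gt0 //; last lra.
    by rewrite ler_wpM2r // ler_pM2l //; lra.
  rewrite /r ler_pdivlMr // mulrC.
  rewrite -(ler_pM2l e_gt0) -(@ler_pM2l _ 2) //.
  by move: hxy; rewrite expr2; lra.
have [F hF] := choice step.
pose G m := if m is m'.+1 then F m' else `[0, e]%classic.
have mG m : measurable (G m) by case: m => [|m] /=; [exact: measurable_itv | case: (hF m)].
pose U := \big[setU/set0]_(m < M.+1) G m.
have mU : measurable U by exact: bigsetU_measurable.
have DU : D `<=` U.
  move=> d Dd; rewrite /U -bigcup_mkord; have [d0 dB] := hD _ Dd.
  have [de|ed] := leP d e.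
    by exists 0%N => //=; rewrite in_itv /= d0.
  have [m hm] := hd _ Dd.
  have Sd0 : 0 <= S * d ^+ 2 by rewrite mulr_ge0 ?sqr_ge0 // ltW.
  have SdB : S * d ^+ 2 <= S * B by rewrite ler_pM2l.
  have hm' := hm; rewrite ler_norml in hm'; case/andP: hm' => hm1 hm2.
  have m0 : 0 <= m.
    rewrite -ltzD1 -(ltr_int R) intrD -(ltrD2r (S * d ^+ 2 - m%:~R)) add0r.
    by apply: le_lt_trans hm2 (lt_le_trans ee _); rewrite addrC subrKA; lra.
  have eqm : m%:~R = `|m|%N%:R :> R by rewrite natr_absz ger0_norm.
  exists `|m|.+1%N.
    rewrite /= ltnS /M ltnS truncn_ge_nat -?eqm; last by rewrite addr_ge0 // mulr_ge0 // ltW.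
    by lra.
  by case: (hF `|m|%N) => h _ _; apply: h; split; [ | exact: ltW | rewrite -eqm].
apply: le_trans (lebesgue_measure_mono DU) _.
have := @content_subadditive _ _ _ (@lebesgue_measure R) U G M.+1 (fun k _ => mG k) mU
  (@subset_refl _ U).
move=> h; apply: le_trans h _.
rewrite big_ord_recl /=.
apply: le_trans (_ : (e%:E + \sum_(i < M) (2 * r)%:E <= _)%E).
  apply: leeD; last by apply: lee_sum => i _; case: (hF i).
  by rewrite lebesgue_measure_itv /= lte_fin e_gt0 oppr0 adde0.
rewrite sumEFin -EFinD lee_fin sumr_const card_ord -mulr_natl.
apply: le_trans e_e0.
have hM : M%:R <= S * B + 2.
  rewrite /M -natr1.
  have : (Num.truncn (S * B + 1))%:R <= S * B + 1.
    by rewrite truncn_le addr_ge0 // mulr_ge0 // ltW.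
  by lra.
have : M%:R * (2 * r) <= (S * B + 2) * (2 * r) by rewrite ler_wpM2r // mulr_ge0.
have -> : (S * B + 2) * (2 * r) = 2 * B * e + 4 * e / S by rewrite /r; field; rewrite gt_eqF.
have : 4 * e / S <= 4 * e by rewrite ler_pdivrMr // ler_peMr // mulr_ge0 // ltW.
by lra.
Qed.

End NullSets.

(** * Compactness, and the measure of the distance set *)

Section CompactNull.
Variables (R : realType) (n : nat).
Hypothesis n_gt0 : (0 < n)%N.

Lemma nbhs_prefix (w : cantor_space) M :
  nbhs w [set w' | forall m, (m < M)%N -> w m = w' m].
Proof.
elim: M => [|M ih]; first by apply: filterS filterT => w' _ m.
have hM : nbhs w [set w' : cantor_space | w M = w' M].
  have := @proj_continuous nat (fun=> bool) M w [set w M].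
  by move=> h; apply: filterS (h (discrete_set1 _)) => w' /= ->.
near=> w'; move=> m; rewrite ltnS leq_eqVlt => /orP[/eqP->|]; first by near: w'.
by move: m; near: w'.
Unshelve. all: by end_near.
Qed.

Lemma point_continuous : continuous (point R n : cantor_space -> 'rV[R]_n).
Proof.
move=> w; apply/cvg_ballP => e e0.
have [P hP] := expr2V_arch e0.
near=> w'; split=> // i j; rewrite (ord1 i); apply: le_lt_trans hP.
apply: point_near; near: w'; exact: nbhs_prefix.
Unshelve. all: by end_near.
Qed.

Lemma range_point_compact : compact (range (point R n)).
Proof.
apply: (@continuous_compact cantor_space 'rV[R]_n (point R n) setT).
  by apply: continuous_subspaceT; exact: point_continuous.
exact: cantor_space_compact.
Qed.

Lemma distance_set_point_null :
  lebesgue_measure (distance_set (range (point R n))) = 0%E.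
Proof.
have nR : 0 < n%:R :> R by rewrite ltr0n.
apply: (@null_near_integers _ _ n%:R).
  move=> _ [_ [_ [[w _ <-] [w' _ <-] ->]]]; split; first exact: sqrtr_ge0.
  rewrite eucl_dist_sqr -[X in X%:R]card_ord -sumr_const; apply: ler_sum => i _.
  by rewrite -real_normK ?num_real // expr_le1 // point_diff_le1.
(* The distance to an integer will be at most [2 * n * theta + 3 * n * eta <= 5 * n * theta], and
   [theta] is below [2 ^- k]. *)
move=> d d0; have [k hk] := expr2V_arch (divr_gt0 d0 (mulr_gt0 (ltr0n R 5) nR)).
exists (scale R k ^+ 2).
  by rewrite scale2_int ler1z !exprn_ege1.
move=> _ [_ [_ [[w _ <-] [w' _ <-] ->]]].
pose c (i : 'I_n) : R := (shift_bit i k w)%:R - (shift_bit i k w')%:R.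
have [m hm] := @eucl_dist_stage R n k w w' c (fun i => erefl).
exists m; set s := \sum_i _ in hm.
have hs : `|s| <= n%:R.
  apply: le_trans (ler_norm_sum _ _ _) _.
  rewrite -[X in _ <= X%:R]card_ord -sumr_const; apply: ler_sum => i _.
  have [h1 h2 _] := point_stage_diff R w w' i k.
  by rewrite normrM -[leRHS]mul1r ler_pM.
have th0 := theta_gt0 R k; have het := eta_theta R k.
have hths : `|2 * theta R k * s| <= 2 * (theta R k * n%:R).
  by rewrite !normrM (gtr0_norm th0) gtr0_norm // -mulrA ler_pM2l // ler_pM2l.
have hne : n%:R * eta R k <= n%:R * theta R k by rewrite ler_pM2l.
have hthk : theta R k <= (2 ^+ k)^-1.
  by rewrite theta_exp; exact: (@expr2V_le R k k.+2 (leqW (leqnSn k))).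
have hfin : 5 * (theta R k * n%:R) <= d.
  rewrite (mulrC (theta R k)) mulrA mulrC -ler_pdivlMr ?mulr_gt0 ?ltr0n //.
  by apply: le_trans hthk _; exact: ltW.
move: hm; set D := scale R k ^+ 2 * _ - _ => hm.
have := ler_normD (D - 2 * theta R k * s) (2 * theta R k * s); rewrite subrK => hD.
apply: le_trans hD _; lra.
Qed.

End CompactNull.

(** * Estimates for Hausdorff measure and dimension *)

Section Hausdorff.
Variables (R : realType) (n : nat).
Implicit Types (U E : set 'rV[R]_n) (s r : R).

Lemma eucl_dist_ge0 (x y : 'rV[R]_n) : 0 <= eucl_dist x y.
Proof. exact: sqrtr_ge0. Qed.

Lemma coord_le_eucl_dist (x y : 'rV[R]_n) i :
  `|x ord0 i - y ord0 i| <= eucl_dist x y.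
Proof.
rewrite -(ler_pXn2r (ltn0Sn 1)) ?nnegrE ?eucl_dist_ge0 //.
rewrite real_normK ?num_real // eucl_dist_sqr (bigD1 i) //= lerDl.
by apply: sumr_ge0 => j _; exact: sqr_ge0.
Qed.

Lemma eucl_dist_le_coord (x y : 'rV[R]_n) r : 0 <= r ->
  (forall i, `|x ord0 i - y ord0 i| <= r) -> eucl_dist x y <= n%:R * r.
Proof.
move=> r0 h; rewrite -(ler_pXn2r (ltn0Sn 1)) ?nnegrE ?eucl_dist_ge0 ?mulr_ge0 //.
rewrite eucl_dist_sqr; apply: le_trans (_ : \sum_(i < n) r ^+ 2 <= _).
  by apply: ler_sum => i _; rewrite -real_normK ?num_real // ler_pXn2r ?nnegrE.
rewrite sumr_const card_ord -[leLHS]mulr_natl exprMn ler_wpM2r ?sqr_ge0 //.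
by rewrite -natrX ler_nat -mulnn; case: (n) => // m; rewrite leq_pmulr.
Qed.

Lemma ediam_le U r : (forall x y, U x -> U y -> eucl_dist x y <= r) ->
  (ediam U <= r%:E)%E.
Proof.
move=> h; apply/ereal_supP => _ [_ [x [y [Ux Uy ->]]] <-].
by rewrite lee_fin h.
Qed.

Lemma diam_pow_ge0 s U : (0 <= diam_pow s U)%E.
Proof. by rewrite /diam_pow; case: ifP => // _; exact: poweR_ge0. Qed.

(** The point [x] excludes the value [-oo] and the bound [r] excludes [+oo]. *)
Lemma ediam_fin U x r : U x -> (ediam U <= r%:E)%E ->
  exists d, [/\ 0 <= d, ediam U = d%:E &
    forall y z, U y -> U z -> eucl_dist y z <= d].
Proof.
move=> Ux hr.
have h y z : U y -> U z -> ((eucl_dist y z)%:E <= ediam U)%E.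
  by move=> Uy Uz; apply: ereal_sup_ubound; exists (eucl_dist y z) => //; exists y, z.
have h0 : (0 <= ediam U)%E by apply: le_trans (h _ _ Ux Ux); rewrite lee_fin eucl_dist_ge0.
case e : (ediam U) h0 hr h => [d| |] //; rewrite !lee_fin => d0 _ h.
by exists d; split.
Qed.

Lemma diam_pow_le s U r : 0 <= s -> 0 <= r ->
  (forall x y, U x -> U y -> eucl_dist x y <= r) -> (diam_pow s U <= (r `^ s)%:E)%E.
Proof.
move=> s0 r0 h; rewrite /diam_pow; case: ifPn => [_|/set0P[x Ux]].
  by rewrite lee_fin powR_ge0.
have [d [d0 e _]] := ediam_fin Ux (ediam_le h).
have := ediam_le h; rewrite e /= !lee_fin => dr.
by rewrite ge0_ler_powR ?nnegrE.
Qed.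

Lemma hausdorff_content_ge0 s delta E : (0 <= hausdorff_content s delta E)%E.
Proof.
apply/ereal_infP => _ [U _ <-]; apply: nneseries_ge0 => i _ _; exact: diam_pow_ge0.
Qed.

Lemma hausdorff_measure_eq0 s E :
  (forall delta e, 0 < delta -> 0 < e -> exists2 U, delta_cover delta E U &
     (\sum_(0 <= i <oo) diam_pow s (U i) <= e%:E)%E) ->
  hausdorff_measure s E = 0%E.
Proof.
move=> h; apply/eqP; rewrite eq_le; apply/andP; split.
  apply/ereal_supP => _ [delta /= d0 <-].
  apply/lee_addgt0Pr => e e0; rewrite add0e.
  have [U hU he] := h _ _ d0 e0.
  by apply: le_trans he; apply: ereal_inf_lbound; exists U.
apply: le_trans (hausdorff_content_ge0 s 1 E) _.
by apply: ereal_sup_ubound; exists 1 => //=; exact: ltr01.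
Qed.

(* Mass distribution principle: the Lebesgue measure on [0, 1) is carried to
   [E] by the inverse of a Hoelder map. *)
Lemma hausdorff_measure_holder (T : Type) (f : T -> 'rV[R]_n) (g : T -> R) s C :
  0 < C -> (forall t, 0 <= t < 1 -> exists w, g w = t) ->
  (forall w w', `|g w - g w'| <= C * eucl_dist (f w) (f w') `^ s) -> 0 <= s ->
  (0 < hausdorff_measure s (range f))%E.
Proof.
move=> C0 gsurj gh s0.
(* The 2 comes from [small_diam_cover], whose interval is twice as long as the diameter bound. *)
apply: lt_le_trans (_ : (((2 * C)^-1)%:E <= _)%E).
  by rewrite lte_fin invr_gt0 mulr_gt0.
(* Any single [delta] bounds the supremum from below; the value 1 serves to make all diameters
   finite. *)
apply: le_trans (_ : _ <= hausdorff_content s 1 (range f))%E _; last first.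
  by apply: ereal_sup_ubound; exists 1 => //=; exact: ltr01.
apply/ereal_infP => _ [U [cov diamU] <-].
pose T' i := [set g w | w in [set w | U i (f w)]].
have step i : exists B : set R, [/\ T' i `<=` B, measurable B &
    (lebesgue_measure B <= (2 * C)%:E * diam_pow s (U i))%E].
  rewrite /diam_pow; case: ifPn => [/eqP U0|/set0P[x Ux]].
    exists set0; rewrite measure0 mule0; split => // t [w /=].
    by rewrite U0.
  have [d [d0 -> hd]] := ediam_fin Ux (diamU i).
  have [||B [h1 h2 h3]] := @small_diam_cover R (T' i) (C * d `^ s).
  - by rewrite mulr_ge0 ?powR_ge0 // ltW.
  - move=> _ _ [w Uw <-] [w' Uw' <-]; apply: le_trans (gh _ _) _.
    by rewrite ler_pM2l // ge0_ler_powR ?nnegrE ?eucl_dist_ge0 // hd.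
  by exists B; split=> //; rewrite /= -EFinM -mulrA.
have [B hB] := choice step.
have mB i : measurable (B i) by case: (hB i).
have sub : `[0, 1[%classic `<=` \bigcup_i B i.
  move=> t /=; rewrite in_itv /= => /gsurj[w <-].
  have [i _ Ui] := cov (f w) (imageT f w).
  by exists i => //; case: (hB i) => + _ _; apply; exists w.
have l01 : lebesgue_measure (`[0, 1[%classic : set R) = 1%:E.
  by rewrite lebesgue_measure_itv /= lte_fin ltr01 oppr0 adde0.
have h : (1%:E <= \sum_(0 <= i <oo) lebesgue_measure (B i))%E.
  rewrite -l01.
  exact: (measure_sigma_subadditive (@lebesgue_measure R) mB (measurable_itv `[0, 1[) sub).
rewrite -(@lee_pmul2l _ (2 * C)%:E) ?lte_fin ?mulr_gt0 // -EFinM divff ?gt_eqF ?mulr_gt0 //.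
apply: le_trans h _; rewrite -nneseriesZl; last by move=> i _; exact: diam_pow_ge0.
by apply: lee_nneseries => i *; [exact: lebesgue_measure_ge0 | case: (hB i)].
Qed.

Lemma hausdorff_dim_eq E s : 0 <= s ->
  (forall t, s < t -> hausdorff_measure t E = 0%E) ->
  (forall t, 0 <= t < s -> hausdorff_measure t E <> 0%E) -> hausdorff_dim E = s%:E.
Proof.
move=> s0 hu hl; apply/eqP; rewrite eq_le; apply/andP; split.
  apply/lee_addgt0Pr => e e0; apply: ereal_inf_lbound.
  exists (s + e) => //=; split; first by rewrite addr_ge0 // ltW.
  by apply: hu; rewrite ltrDl.
apply/ereal_infP => _ [t [t0 ht] <-]; rewrite lee_fin leNgt; apply/negP => ts.
by apply: (hl t) => //; rewrite t0.
Qed.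

End Hausdorff.

(** * The dimension of the set of points *)

Section PointDimension.
Variables (R : realType) (n : nat).
Hypothesis n_gt0 : (0 < n)%N.

Let nR_gt0 : 0 < n%:R :> R. Proof. by rewrite ltr0n. Qed.

Lemma powR2_exp (P : nat) (t : R) : ((2 ^+ P)^-1) `^ t = 2 `^ (- (P%:R * t)).
Proof. by rewrite -powR_mulrn // -powRN -powRrM mulNr. Qed.

Lemma powR2N_exp (P : nat) : 2 `^ (- P%:R) = ((2 : R) ^+ P)^-1.
Proof. by rewrite powRN powR_mulrn. Qed.

(** If the words first differ at [m], their values differ by at most [2 ^- m], while by [point_sep]
    the points are at least [2 ^- (y ^ 2 + 1)] apart, where [y = r.+1] and
    [n * y ^ 2 <= 2 * m + 22 * n * y]. *)
Lemma point_holder (s : R) : 0 <= s < n%:R / 2 -> exists2 C : R, 0 < C &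
  forall w w', `|bval R w - bval R w'| <= C * eucl_dist (point R n w) (point R n w') `^ s.
Proof.
move=> /andP[s0 sn]; pose ep : R := n%:R / 2 - s.
have ep0 : 0 < ep by rewrite subr_gt0.
(* The fraction is minus the minimum over [y] of [ep * y ^ 2 - 11 * n * y]; the summand [s] pays for
   the [+ 1] in the exponent. *)
pose c := s + (11 * n%:R) ^+ 2 / (4 * ep).
exists (2 `^ c); first by rewrite powR_gt0.
move=> w w'; have [->|/first_diff[m hm h]] := pselect (w = w').
  by rewrite subrr normr0 mulr_ge0 ?powR_ge0.
have [r [i [hr hd]]] := point_sep R n_gt0 h hm.
apply: le_trans (@bval_near R _ _ m h) _.
have dge : (2 ^+ (r.+1 ^ 2).+1)^-1 <= eucl_dist (point R n w) (point R n w').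
  exact: le_trans hd (coord_le_eucl_dist _ _ _).
apply: le_trans (_ : 2 `^ c * ((2 ^+ (r.+1 ^ 2).+1)^-1) `^ s <= _); last first.
  rewrite ler_wpM2l ?powR_ge0 //; apply: ge0_ler_powR => //; rewrite nnegrE.
    exact: ltW (expr2V_gt0 _ _).
  exact: eucl_dist_ge0.
rewrite powR2_exp -powRD; last by rewrite pnatr_eq0 implybT.
rewrite -powR2N_exp ler_powR ?ler1n //.
have hmn : (n * (m %/ n) <= m)%N by rewrite mulnC leq_trunc_div.
move: hmn hr; rewrite -(ler_nat R) natrM => hmn hr.
have {}hr : (r.+1%:R ^+ 2 <= 2 * (m %/ n)%:R + 22 * r.+1%:R :> R).
  rewrite -natrX -!natrM -natrD ler_nat; lia.
have hf : n%:R * (r.+1%:R ^+ 2) <= n%:R * (2 * (m %/ n)%:R + 22 * r.+1%:R) :> R.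
  by rewrite ler_pM2l.
rewrite -addn1 natrD natrX; move: hf hmn; rewrite /c.
set y : R := r.+1%:R; set f : R := (m %/ n)%:R; set M : R := m%:R; set N : R := n%:R.
move=> hf hmn.
have key : 0 <= ep * y ^+ 2 - 11 * N * y + (11 * N) ^+ 2 / (4 * ep).
  have -> : ep * y ^+ 2 - 11 * N * y + (11 * N) ^+ 2 / (4 * ep) =
      (2 * ep * y - 11 * N) ^+ 2 / (4 * ep) by field; rewrite gt_eqF.
  by rewrite divr_ge0 ?sqr_ge0 // mulr_ge0 // ltW.
move: key; rewrite /ep -/N; set Q := (11 * N) ^+ 2 / _ => key.
have e1 : (y ^+ 2 + 1) * s = s * y ^+ 2 + s by ring.
have e2 : (N / 2 - s) * y ^+ 2 = N * y ^+ 2 / 2 - s * y ^+ 2 by field.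
have e3 : N * (2 * f + 22 * y) = 2 * (N * f) + 22 * (N * y) by ring.
by rewrite e1; move: key hf; rewrite e2 e3; lra.
Qed.

Lemma powR2_arch (c x : R) : 0 < c -> 0 < x -> exists k, forall P, (k <= P)%N ->
  2 `^ (- (P%:R * c)) <= x.
Proof.
move=> c0 x0; have [Q hQ] := expr2V_arch x0.
exists (Num.truncn (Q%:R / c)).+1 => P hP; apply: le_trans (ltW hQ).
rewrite -powR2N_exp ler_powR ?ler1n // lerN2 -ler_pdivrMr //.
apply: le_trans (ltW (truncnS_gt _)) _; rewrite ler_nat //.
Qed.

(** A zone contains no free position, so the letters that determine the digits below [zone_start k]
    already determine those below [zone_end k]. *)
Lemma point_stage_cover (s : R) k : 0 <= s ->
  exists2 U : nat -> set 'rV[R]_n,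
    range (point R n) `<=` \bigcup_i U i &
    (forall i, (ediam (U i) <= (n%:R / 2 ^+ zone_end k)%:E)%E) /\
    (\sum_(0 <= i <oo) diam_pow s (U i) <=
      (2 ^+ (n * zone_start k) * (n%:R / 2 ^+ zone_end k) `^ s)%:E)%E.
Proof.
move=> s0; pose L := (nfree (zone_start k) * n)%N.
pose pre w : {ffun 'I_L -> bool} := [ffun j : 'I_L => w (j : nat)].
(* One cell for each prefix of length [L]; from index [2 ^ L] on the cells are empty and contribute
   0. *)
pose U i := point R n @` [set w | (enum_rank (pre w) : nat) = i].
have r0 : 0 <= n%:R / 2 ^+ zone_end k :> R by rewrite divr_ge0 // exprn_ge0.
have hU i x y : U i x -> U i y -> eucl_dist x y <= n%:R / 2 ^+ zone_end k.
  move=> [w /= hw <-] [w' /= hw' <-].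
  have e : pre w = pre w' by apply/enum_rank_inj/val_inj; rewrite /= hw hw'.
  apply: eucl_dist_le_coord => [|j]; first exact: ltW (expr2V_gt0 _ _).
  apply: point_near => m; rewrite nfree_zone_end => hm.
  by have := congr1 (fun g : {ffun 'I_L -> bool} => g (Ordinal hm)) e; rewrite !ffunE.
exists U.
  by move=> _ [w _ <-]; exists (enum_rank (pre w) : nat) => //; exists w.
split=> [i|]; first exact: ediam_le (hU i).
have U0 i : (2 ^ L <= i)%N -> diam_pow s (U i) = 0%E.
  move=> hi; rewrite /diam_pow; case: ifPn => // /set0P[_ [w /= hw _]].
  have := ltn_ord (enum_rank (pre w)).
  rewrite hw cardE -cardT card_ffun card_bool card_ord => h.
  by have := leq_ltn_trans hi h; rewrite ltnn.
rewrite (nneseries_split 0 (2 ^ L)); last by move=> *; exact: diam_pow_ge0.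
rewrite add0n eseries0 ?adde0; last by move=> i hi _; exact: U0.
apply: le_trans (_ : \sum_(0 <= i < 2 ^ L) ((n%:R / 2 ^+ zone_end k) `^ s)%:E <= _)%E.
  by apply: lee_sum => i _; apply: diam_pow_le => //; exact: hU.
rewrite big_mkord sumEFin lee_fin sumr_const card_ord -[leLHS]mulr_natl.
rewrite ler_wpM2r ?powR_ge0 // natrX ler_weXn2l ?ler1n //.
by rewrite /L (mulnC _ n) leq_mul2l nfree_le orbT.
Qed.

(** As [zone_end k >= 2 * zone_start k], the cover sum is at most [n ^ s * 2 ^ (- zone_start k * (2
    * s - n))], which tends to 0. *)
Lemma hausdorff_measure_point_eq0 (s : R) : n%:R / 2 < s ->
  hausdorff_measure s (range (point R n)) = 0%E.
Proof.
move=> sn; have s0 : 0 < s by apply: lt_trans sn; rewrite divr_gt0.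
apply: hausdorff_measure_eq0 => delta e d0 e0.
have c0 : 0 < 2 * s - n%:R by lra.
have ns0 : 0 < n%:R `^ s :> R by rewrite powR_gt0.
have [k1 hk1] := powR2_arch c0 (divr_gt0 e0 ns0).
have [k2 hk2] := expr2V_arch (divr_gt0 d0 nR_gt0).
pose k := maxn k1 k2.
have [U cU [dU sU]] := point_stage_cover k (ltW s0).
have kz : (k <= zone_start k)%N by exact: ltnW (zone_start_gt k).
have kz' : (k <= zone_end k)%N.
  by apply: leq_trans kz _; rewrite /zone_end mul2n -addnn -addnA leq_addr.
exists U.
  split=> // i; apply: le_trans (dU i) _; rewrite lee_fin.
  rewrite mulrC -ler_pdivlMr //; apply: le_trans (ltW hk2).
  by apply: expr2V_le; apply: leq_trans kz'; exact: leq_maxr.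
apply: le_trans sU _; rewrite lee_fin.
rewrite powRM ?invr_ge0 ?exprn_ge0 // mulrCA -ler_pdivlMl // [leRHS]mulrC.
apply: le_trans (hk1 (zone_start k) (leq_trans (leq_maxl _ _) kz)).
rewrite powR2_exp -powR_mulrn // -powRD; last by rewrite pnatr_eq0 implybT.
rewrite ler_powR ?ler1n // natrM.
have hz : 2 * (zone_start k)%:R <= (zone_end k)%:R :> R.
  by rewrite -natrM ler_nat /zone_end leq_addr.
have : 2 * (zone_start k)%:R * s <= (zone_end k)%:R * s by rewrite ler_pM2r.
by rewrite mulrBr; lra.
Qed.

Lemma hausdorff_dim_point : hausdorff_dim (range (point R n)) = (n%:R / 2)%:E.
Proof.
apply: hausdorff_dim_eq => [|t|t ht]; first by rewrite divr_ge0.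
  exact: hausdorff_measure_point_eq0.
have [C C0 hC] := point_holder ht; case/andP: ht => t0 _ e.
have := hausdorff_measure_holder C0 (@bval_surj R) hC t0.
by rewrite e ltxx.
Qed.

End PointDimension.

(** * Distances, directions and collinear triples *)

Section PointConfigurations.
Variables (R : realType) (n : nat).
Hypothesis n_gt0 : (0 < n)%N.
Let E := range (point R n).
Implicit Types x y z v : 'rV[R]_n.

Lemma eucl_distC x y : eucl_dist x y = eucl_dist y x.
Proof.
rewrite /eucl_dist /eucl_norm; congr Num.sqrt.
by apply: eq_bigr => i _; rewrite !mxE -sqrrN opprB.
Qed.

Lemma eucl_distxx x : eucl_dist x x = 0.
Proof.
apply/eqP; rewrite -sqrf_eq0 eucl_dist_sqr big1 // => i _.
by rewrite subrr expr0n.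
Qed.

(* A realisation of a distance or direction by two different pairs involves a
   point distinct from the three others. *)
Lemma eq_set2_or_isolated x y z v : x != y ->
  [\/ [set x; y] = [set z; v], x != z /\ x != v | y != z /\ y != v].
Proof.
move=> xy; have [xz|xz] := eqVneq x z.
  have [yv|yv] := eqVneq y v; first by constructor 1; rewrite xz yv.
  by constructor 3; rewrite -xz eq_sym.
have [xv|xv] := eqVneq x v; last by constructor 2.
have [yz|yz] := eqVneq y z; first by constructor 1; rewrite xv yz setUC.
by constructor 3; rewrite -xv eq_sym.
Qed.

Lemma range_point_dist_diff x y z v (a : int) (b : nat) : (0 < b)%N ->
  E x -> E y -> E z -> E v -> x != y -> x != z -> x != v ->
  b%:R * (eucl_dist x y ^+ 2 - eucl_dist z v ^+ 2) <> a%:~R.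
Proof.
move=> b0 [w _ <-] [wy _ <-] [wz _ <-] [wv _ <-] hy hz hv.
apply: dist_diff_irrational => // e.
- by move: hy; rewrite e eqxx.
- by move: hz; rewrite e eqxx.
- by move: hv; rewrite e eqxx.
Qed.

Lemma range_point_distances_once : distances_realised_once E.
Proof.
move=> x y z v Ex Ey Ez Ev e d0.
have xy : x != y by apply/eqP => xy; move: d0; rewrite -e xy eucl_distxx ltxx.
have [//|[xz xv]|[yz yv]] := eq_set2_or_isolated z v xy; exfalso.
  apply: (@range_point_dist_diff x y z v 0 1) => //.
  by rewrite e subrr mulr0.
apply: (@range_point_dist_diff y x z v 0 1) => //; first by rewrite eq_sym.
by rewrite eucl_distC e subrr mulr0.
Qed.

Lemma range_point_not_rational x y : E x -> E y -> x != y ->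
  ~ exists q : rat, eucl_dist x y = ratr q.
Proof.
move=> Ex Ey xy [q e].
(* Repeating [y] makes the second distance 0, and the squared distance is the fraction [q ^ 2]. *)
apply: (@range_point_dist_diff x y y y (numq q ^+ 2) (`|denq q| ^ 2)%N) => //.
  by rewrite expn_gt0 absz_gt0 denq_neq0.
rewrite eucl_distxx e expr0n subr0 natrX natr_absz (gtr0_norm (denq_gt0 q)) rmorphXn /=.
have dq : (denq q)%:~R != 0 :> R by rewrite intr_eq0 denq_neq0.
by rewrite -exprMn /ratr mulrC divfK.
Qed.

(** Parallelism makes the 2 by 2 minors vanish; since [n >= 2], each coordinate [j] has a partner
    [i != j] to which [direction_unique] applies. *)
Lemma range_point_parallel_isolated x y z v t : (1 < n)%N ->
  E x -> E y -> E z -> E v -> x != y -> x != z -> x != v ->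
  x - y = t *: (z - v) -> z = v.
Proof.
move=> n1 [w _ <-] [wy _ <-] [wz _ <-] [wv _ <-] hy hz hv /rowP e.
apply/rowP => j.
have [i ij] : exists i : 'I_n, i != j.
  have [j0|j0] := eqVneq (j : nat) 0%N; last by exists (Ordinal n_gt0); rewrite -val_eqE eq_sym.
  by exists (Ordinal n1); rewrite -val_eqE /= j0.
apply: (@direction_unique R n n_gt0 w wy wz wv i j ij).
- by move=> ee; move: hy; rewrite ee eqxx.
- by move=> ee; move: hz; rewrite ee eqxx.
- by move=> ee; move: hv; rewrite ee eqxx.
have c k := e k; have := c i; have := c j.
rewrite !mxE => -> ->.
by rewrite -!mulrA; congr (_ * _); rewrite mulrC.
Qed.

Lemma range_point_directions_once : (1 < n)%N -> directions_realised_once E.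
Proof.
move=> n1 x y z v Ex Ey Ez Ev xy zv [t e].
have [//|[xz xv]|[yz yv]] := eq_set2_or_isolated z v xy.
  by move: zv; rewrite (range_point_parallel_isolated n1 Ex Ey Ez Ev xy xz xv e) eqxx.
move: zv; rewrite eq_sym in xy.
rewrite (@range_point_parallel_isolated y x z v (- t) n1) ?eqxx //.
by rewrite scaleNr -e opprB.
Qed.

(** Two sides of a collinear triple are parallel, against the uniqueness of directions. *)
Lemma range_point_not_collinear x y z : (1 < n)%N ->
  E x -> E y -> E z -> x != y -> y != z -> x != z -> ~ collinear x y z.
Proof.
move=> n1 Ex Ey Ez xy yz xz [p [d [d0 h]]].
have [a ea] := h x (mem_head _ _).
have [b eb] : exists b, y = p + b *: d by apply: h; rewrite !inE eqxx orbT.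
have [c ec] : exists c, z = p + c *: d by apply: h; rewrite !inE eqxx !orbT.
have ab : a - b != 0.
  by apply: contra xy => /eqP/subr0_eq ab; rewrite ea eb ab.
have : [set x; z] = [set x; y].
  apply: range_point_directions_once => //.
  exists ((a - c) / (a - b)).
  have diff s t : p + s *: d - (p + t *: d) = (s - t) *: d.
    by rewrite opprD addrACA subrr add0r scalerBl.
  by rewrite ea eb ec !diff scalerA divfK.
move=> /seteqP[/(_ z)]; rewrite /= => hz _.
case: hz => [|zx|zy]; first by right.
- by move: xz; rewrite zx eqxx.
- by move: yz; rewrite zy eqxx.
Qed.

End PointConfigurations.

Unset Implicit Arguments.
Set Strict Implicit.

Theorem theorem5p3 (R : realType) (n : nat) (hn : (2 <= n)%N) :
  exists E : set 'rV[R]_n,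
    compact E /\
    hausdorff_dim E = (n%:R / 2 : R)%:E /\
    lebesgue_measure (distance_set E) = 0%E /\
    (forall x y, E x -> E y -> x != y ->
       ~ exists q : rat, eucl_dist x y = ratr q) /\
    (forall x y z, E x -> E y -> E z -> x != y -> y != z -> x != z ->
       ~ collinear x y z) /\
    distances_realised_once E /\
    directions_realised_once E.
Proof.
have n_gt0 : (0 < n)%N := ltnW hn.
exists (range (point R n)); do !split.
- exact: range_point_compact.
- exact: hausdorff_dim_point.
- exact: distance_set_point_null.
- by move=> x y; exact: range_point_not_rational.
- by move=> x y z; exact: range_point_not_collinear.
- exact: range_point_distances_once.
- exact: range_point_directions_once.
Qed.
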